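(* Let $T>0$, $m\in\mathbb{N}^*$ and $\mu_m=(m\pi/T)^2$. Consider a graph $G$ with $N$ nodes having a joint at node $k$, whose nodes are labelled $1,2,\dots,N$ in such a way that the sets $\{1,2,\dots,k-1\}$ and $\{k+1,\dots,N\}$ correspond to two disconnected subgraphs of $G$ (i.e. no edge of $G$ joins a node of $\{1,\dots,k-1\}$ to a node of $\{k+1,\dots,N\}$). Choose two distinct indices $i,j\le k$ and two other distinct indices $p,q\ge k$. Then the $(N-2)\times(N-2)$ matrix $A^{ij}_{pq}$ obtained by taking out the two columns $i,j$ and the two rows $p,q$ from $\Delta+\mu_m\mathbf{I}$ is not invertible.
   Context: The graph is undirected. Its graph Laplacian $\Delta$ is the real symmetric $N\times N$ matrix with $\Delta_{rs}=1$ if the nodes $r\neq s$ are joined by an edge, $\Delta_{rs}=0$ if $r\neq s$ are not joined, and $\Delta_{rr}=-\deg(r)$. $\mathbf{I}$ is the $N\times N$ identity matrix and $\mathbb{N}^*=\{1,2,\dots\}$. A joint of a graph is a node whose removal (together with its incident edges) increases the number of disconnected subgraphs, i.e. of connected components. *)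

(* Defs.v *)
From HB Require Import structures.
From mathcomp Require Import all_boot all_order all_algebra.
From mathcomp Require Import reals trigo.

Set Implicit Arguments.
Unset Strict Implicit.
Unset Printing Implicit Defensive.

Import Order.TTheory GRing.Theory Num.Theory.

Local Open Scope ring_scope.

(* A graph on N nodes is a symmetric irreflexive relation on 'I_N; the node   *)
(* labelled r in {1, ..., N} is the ordinal of value r - 1.                   *)

Definition deg (N : nat) (e : rel 'I_N) (r : 'I_N) : nat := #|[set s | e r s]|.

(* Negative semidefinite sign convention: minus the degrees on the diagonal.  *)
Definition laplacian (R : realType) (N : nat) (e : rel 'I_N) : 'M[R]_N :=
  \matrix_(r, s) if r == s then - (deg e r)%:R else (e r s)%:R.

Definition remove_node (T : finType) (e : rel T) (k : T) :
    rel {x : T | x != k} :=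
  fun x y => e (val x) (val y).

Definition joint (T : finType) (e : rel T) (k : T) : bool :=
  (n_comp e predT < n_comp (@remove_node T e k) predT)%N.

Definition mu (R : realType) (T : R) (m : nat) : R := (m%:R * pi / T) ^+ 2.

(* The increasing enumeration of the N - 2 indices other than p and q. For    *)
(* p != q the default value p of nth is never reached.                        *)
Definition skip2 (N : nat) (p q : 'I_N) (r : 'I_(N - 2)) : 'I_N :=
  nth p (enum (~: [set p; q])) r.

Lemma skip2_image (N : nat) (p q : 'I_N) :
  p != q -> skip2 p q @: setT = ~: [set p; q].
Proof.
move=> pq.
have sz : size (enum (~: [set p; q])) = (N - 2)%N.
  by rewrite -cardE cardsCs setCK cards2 pq card_ord.
apply/setP=> x; apply/imsetP/idP => [[r _ ->]|xpq].
  by rewrite -mem_enum mem_nth // sz.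
have xs : x \in enum (~: [set p; q]) by rewrite mem_enum.
have ix : (index x (enum (~: [set p; q])) < N - 2)%N by rewrite -sz index_mem.
by exists (Ordinal ix); rewrite // /skip2 nth_index.
Qed.

(* M with the columns i, j and the rows p, q taken out.                       *)
Definition take_out (R : realType) (N : nat) (M : 'M[R]_N) (i j p q : 'I_N) :
    'M[R]_(N - 2) :=
  mxsub (skip2 p q) (skip2 i j) M.

(* Main.v *)
(** Every row [r < k] survives the deletion and vanishes in every column
    [s > k], all of which survive too. This is a zero block of [k] rows and
    [N - k - 1] columns (indices starting at 0) in a matrix of size [N - 2];
    since the two counts add up to more than [N - 2], no permutation avoids the
    block and all terms of the Leibniz expansion of the determinant vanish. *)

Require Import Defs.
From HB Require Import structures.
From mathcomp Require Import all_boot all_order all_algebra.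
From mathcomp Require Import perm reals trigo.

Set Implicit Arguments.
Unset Strict Implicit.
Unset Printing Implicit Defensive.

Import Order.TTheory GRing.Theory Num.Theory.

Local Open Scope ring_scope.

(** A permutation avoiding the block would inject [A] into the complement of [C], which has fewer
    than [#|A|] elements. *)
Lemma det_zero_block (R : comPzRingType) (n : nat) (M : 'M[R]_n)
    (A C : {set 'I_n}) :
  (n < #|A| + #|C|)%N -> {in A & C, forall r c, M r c = 0} -> \det M = 0.
Proof.
move=> nAC M0; apply: big1 => s _.
have [r rA srC] : exists2 r, r \in A & s r \in C.
  apply/exists_inP; apply: contraLR nAC => /exists_inPn sAC; rewrite -leqNgt.
  have sA : s @: A \subset ~: C.
    by apply/subsetP=> _ /imsetP[r rA ->]; rewrite inE sAC.
  move/subset_leq_card: sA; rewrite card_imset; last exact: perm_inj.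
  by rewrite -(leq_add2l #|C|) cardsC card_ord addnC.
by rewrite (bigD1 r) //= M0 // mul0r mulr0.
Qed.

(** Such a [B] lies in the image of [skip2 p q], so the deletion costs the zero block no row or
    column. *)
Lemma card_skip2_preim (N : nat) (p q : 'I_N) (B : {set 'I_N}) :
  p != q -> p \notin B -> q \notin B -> (#|B| <= #|skip2 p q @^-1: B|)%N.
Proof.
move=> pq pB qB; apply: leq_trans (leq_imset_card (skip2 p q) _).
apply/subset_leq_card/subsetP => x xB.
have : x \in skip2 p q @: setT.
  rewrite skip2_image // !inE negb_or.
  by rewrite (memPn pB) ?(memPn qB).
by case/imsetP=> r _ xr; apply/imsetP; exists r; rewrite // inE -xr.
Qed.

Theorem theorem4p5 (R : realType) (T : R) (hT : 0 < T) (m : nat)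
    (hm : (0 < m)%N) (N : nat) (e : rel 'I_N) (e_sym : symmetric e)
    (e_irr : irreflexive e) (k : 'I_N) (hk : joint e k)
    (hsep : forall r s : 'I_N, (r < k)%N -> (k < s)%N -> ~~ e r s)
    (i j p q : 'I_N) (hij : i != j) (hi : (i <= k)%N) (hj : (j <= k)%N)
    (hpq : p != q) (hp : (k <= p)%N) (hq : (k <= q)%N) :
  take_out (laplacian R e + (mu T m)%:M) i j p q \notin unitmx.
Proof.
pose A := [set r : 'I_N | (r < k)%N]; pose C := [set s : 'I_N | (k < s)%N].
(* Subtraction is truncated: [N - 2 < N.-1] needs [1 < N]. *)
have N_gt1 : (1 < N)%N by have := max_card [set p; q]; rewrite cards2 hpq card_ord.
rewrite unitmxE.
rewrite (@det_zero_block _ _ _ (skip2 p q @^-1: A) (skip2 i j @^-1: C)).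
- by rewrite unitr0.
(* [A] and [C] together miss only [k]. *)
- have AC : (N.-1 <= #|A| + #|C|)%N.
    rewrite -{1}(card_ord N) -(cardsC1 k).
    apply: leq_trans (leq_card_setU A C).1.
    by apply/subset_leq_card/subsetP=> x; rewrite !inE -neq_ltn.
  have Ale : (#|A| <= #|skip2 p q @^-1: A|)%N.
    by apply: card_skip2_preim; rewrite // inE -leqNgt.
  have Cle : (#|C| <= #|skip2 i j @^-1: C|)%N.
    by apply: card_skip2_preim; rewrite // inE -leqNgt.
  apply: leq_trans (leq_trans AC (leq_add Ale Cle)).
  by rewrite subn2 prednK // -subn1 subn_gt0.
- move=> r s; rewrite !inE => rk ks; rewrite !mxE.
  (* The original indices lie on opposite sides of [k], so the entry is off the diagonal and neither
     a degree nor [mu T m] enters. *)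
  have /negPf-> : skip2 p q r != skip2 i j s.
    by rewrite neq_ltn (ltn_trans rk ks).
  by rewrite (negPf (hsep _ _ rk ks)) addr0.
Qed.
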